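(* Let $E$ be a finite-dimensional complex Hilbert space, $A(s)=A_0s^2+(A_1+A_1^* )s+A_2$ a self-adjoint quadratic polynomial with values in $\operatorname{End}(E)$ with $A_0$ positive definite, all of whose real eigenvalues are of positive or negative type. Let $\sigma\subset\operatorname{spec}(A)\cap\{\operatorname{Im}s\ge0\}$ be an admissible set, and let $Q$ be the corresponding $\sigma$-spectral right root and $Z=-i(A_0Q+A_1)$ the impedance. Let $u\in E$, and denote by $u_s$ the $\ker A(s)$-component of $u$ with respect to the decomposition $E=E_c\oplus\bigoplus_{s\in\sigma\cap\mathbb R}\ker A(s)$. Then $$2\operatorname{Im}(u|Zu)=\sum_{s\in\sigma\cap\mathbb R}(A'(s)u_s|u_s).$$ If $\sigma$ has positive (resp. negative) type, then $\operatorname{Im}(u|Zu)\ge0$ (resp. $\operatorname{Im}(u|Zu)\le0$) holds for $u\in E$, with strict inequality if $u\notin E_c$.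
   Context: The scalar product $(x|y)$ of $E$ is linear in $x$ and conjugate linear in $y$; ${}^*$ denotes the adjoint. Self-adjointness of $A$ means $A(s)^*=A(\bar s)$, i.e. $A_0,A_2$ are self-adjoint. $\operatorname{spec}(A)$ is the (finite, conjugation-invariant) set of $s\in\mathbb C$ for which $A(s)$ is singular; $A'(s)$ is the derivative. A real $s\in\operatorname{spec}(A)$ is of positive (negative) type iff $(A'(s)v|v)>0$ ($<0$) for all $0\neq v\in\ker A(s)$. Admissible $\sigma$: put $\sigma^\sharp=\operatorname{spec}(A)\setminus\sigma$; complex conjugation maps $\sigma\setminus\mathbb R$ bijectively onto $\sigma^\sharp\setminus\mathbb R$; the eigenvalues in $\sigma\cap\mathbb R$ are all of the same type, opposite to the type of the eigenvalues in $\sigma^\sharp\cap\mathbb R$; and $\sigma\subset\{\operatorname{Im}s\geq0\}$. $\sigma$ is of positive (negative) type if the real eigenvalues in $\sigma$ are of positive (negative) type and those in $\sigma^\sharp$ are of the opposite type. For such $\sigma$ there is a unique factorization $A(s)=(s-Q^\sharp)A_0(s-Q)$ with $\operatorname{spec}(Q)=\sigma$ and $\operatorname{spec}(Q^\sharp)=\sigma^\sharp$; $Q$ is called the $\sigma$-spectral right root. $E_c$ is the sum of the generalized eigenspaces of $Q$ for its non-real eigenvalues; the real eigenvalues of $Q$ are semisimple with eigenspaces $\ker(Q-s)=\ker A(s)$, so $E=E_c\oplus\bigoplus_{s\in\sigma\cap\mathbb R}\ker A(s)$. *)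

(* Defs.v *)
From HB Require Import structures.
From mathcomp Require Import all_boot all_order all_algebra finmap.
From mathcomp Require Import boolp classical_sets functions reals complex.
From mathcomp Require Import ring.

Set Implicit Arguments.
Unset Strict Implicit.
Unset Printing Implicit Defensive.

Import Order.TTheory GRing.Theory Num.Theory.
Local Open Scope classical_set_scope.
Local Open Scope ring_scope.

(* A finite-dimensional complex Hilbert space is a [vectType] over [R[i]] with
   a positive definite form [{dot E for Num.conj}], linear in its first and
   conjugate linear in its second argument.  In the order of [R[i]], [0 <= z]
   and [0 < z] include the assertion that [z] is real; ['Im z] is a real
   element of [R[i]]. *)

Section Operators.
Variables (R : realType) (E : vectType R[i]).
Variable form : {dot E for @Num.conj R[i]}.
Implicit Types f g Q : 'End(E).

Definition is_adjoint f g := forall u v, form (f u) v = form u (g v).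

Definition adjoint f : 'End(E) := xget 0 [set g | is_adjoint f g].

Lemma adjointP f : is_adjoint f (adjoint f).
Proof.
suff [g fg] : exists g, is_adjoint f g by apply: (@xgetPex _ 0); exists g.
pose n := \dim {:E}; pose e (i : 'I_n) := (vbasis {:E})`_i.
pose rowf (h : 'End(E)) (w : E) : 'rV_n := \row_i form w (h (e i)).
have rowf_lin h : linear (rowf h).
  by move=> a u v; apply/rowP=> i; rewrite !mxE linearDl linearZl_LR.
pose rowL h : 'Hom(E, 'rV[R[i]]_n) := linfun (HB.pack (rowf h)
  (GRing.isLinear.Build _ _ _ _ (rowf h) (rowf_lin h)) : {linear E -> 'rV_n}).
have rowLE h w : rowL h w = rowf h w by rewrite lfunE.
clearbody rowL.
pose S := rowL \1%VF.
have extE w w' : (forall i, form (e i) w = form (e i) w') ->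
    forall u, form u w = form u w'.
  move=> eww' u; rewrite (coord_vbasis (memvf u)).
  rewrite !linear_sumlz; apply: eq_bigr => i _ /=.
  by rewrite !linearZl_LR /= eww'.
have formC u v : form u v = (form v u)^* by rewrite hermC mul1r.
have kerS : lker S == 0%VS.
  apply/lker0P => u v; rewrite !rowLE => /rowP Suv.
  apply/eqP; rewrite -subr_eq0; apply/negPn/negP => /(neq0_dnorm_gt0 (s := form)).
  have -> : form (u - v) (u - v) = 0; last by rewrite ltxx.
  rewrite (extE _ 0) ?linear0r // => i.
  rewrite linear0r formC; have := Suv i; rewrite !mxE id_lfunE linearBl => Sui.
  by apply/eqP; rewrite fmorph_eq0 subr_eq0; apply/eqP.
have imS : limg S = fullv.
  apply/eqP; rewrite eqEdim subvf /= limg_dim_eq ?(eqP kerS) ?capv0 //.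
  by rewrite [leqLHS]dimvf {1}/dim /= mul1n.
exists (S^-1 \o rowL f)%VF => u v; rewrite comp_lfunE.
set w := (S^-1)%VF _.
have Sw : S w = rowL f v by rewrite limg_lfunVK // imS memvf.
have ei i : form (f (e i)) v = form (e i) w.
  move/rowP: Sw => /(_ i); rewrite !rowLE !mxE id_lfunE => Sw.
  by rewrite formC -Sw -formC.
rewrite (coord_vbasis (memvf u)) linear_sum !linear_sumlz.
by apply: eq_bigr => i _ /=; rewrite linearZ !linearZl_LR /= -ei.
Qed.

Definition self_adjoint f := adjoint f = f.

Definition positive_definite f :=
  self_adjoint f /\ forall v, v != 0 -> 0 < form (f v) v.

Definition op_spec Q : set R[i] := [set s | passmx.leigenvalue Q s].

(* [ker (Q - s)^(dim E)]; endomorphisms of a possibly zero space carry no ring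
   structure, hence the iterated composition. *)
Definition gen_eigenspace Q (s : R[i]) : {vspace E} :=
  lker (iter (\dim {:E}) (comp_lfun (Q - s *: \1)) \1)%VF.

End Operators.

(* [Quad P2 P1 P0] is the quadratic polynomial [s^2 P2 + s P1 + P0]. *)
Record quad (R : realType) (E : vectType R[i]) :=
  Quad { qc2 : 'End(E); qc1 : 'End(E); qc0 : 'End(E) }.

Section Quadratic.
Variables (R : realType) (E : vectType R[i]).
Variable form : {dot E for @Num.conj R[i]}.
Implicit Types (A : quad E) (sigma : {fset R[i]}) (Q : 'End(E)) (s : R[i]).

Definition quad_eval A s : 'End(E) := s ^+ 2 *: qc2 A + s *: qc1 A + qc0 A.

(* [A'(s)]; see [quad_derivE] below. *)
Definition quad_deriv A s : 'End(E) := (2 * s) *: qc2 A + qc1 A.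

Lemma quad_derivE A s h :
  quad_eval A (s + h) = quad_eval A s + h *: quad_deriv A s + h ^+ 2 *: qc2 A.
Proof.
rewrite /quad_eval /quad_deriv; set P2 := qc2 A; set P1 := qc1 A.
have -> : (s + h) ^+ 2 = s ^+ 2 + h * (2 * s) + h ^+ 2 by ring.
rewrite !scalerDl scalerDr scalerA -!addrA; congr (_ + _).
rewrite [h ^+ 2 *: P2 + _]addrC -addrA addrCA; congr (_ + _).
by rewrite [RHS]addrCA; congr (_ + _); rewrite addrAC addrC.
Qed.

Definition quad_spec A : set R[i] := [set s | lker (quad_eval A s) != 0%VS].

Definition positive_type A s := forall v,
  v \in lker (quad_eval A s) -> v != 0 -> 0 < form (quad_deriv A s v) v.

Definition negative_type A s := forall v,
  v \in lker (quad_eval A s) -> v != 0 -> form (quad_deriv A s v) v < 0.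

Definition sharp A sigma : set R[i] := quad_spec A `\` [set` sigma].

Definition sigma_positive A sigma :=
  (forall s, s \in sigma -> s \is Num.real -> positive_type A s) /\
  (forall s, sharp A sigma s -> s \is Num.real -> negative_type A s).

Definition sigma_negative A sigma :=
  (forall s, s \in sigma -> s \is Num.real -> negative_type A s) /\
  (forall s, sharp A sigma s -> s \is Num.real -> positive_type A s).

(* [quad_spec A] is finite when [qc2 A] is invertible, so taking [sigma] to be
   a finite set is no restriction. *)
Definition admissible A sigma :=
  [/\ [set` sigma] `<=` quad_spec A,
      set_bij ([set` sigma] `\` [set s | s \is Num.real])
              (sharp A sigma `\` [set s | s \is Num.real]) (@Num.conj R[i]),
      sigma_positive A sigma \/ sigma_negative A sigma
    & forall s, s \in sigma -> 0 <= 'Im s].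

Definition spectral_right_root A sigma Q :=
  exists Qsharp : 'End(E),
    [/\ forall s, quad_eval A s =
          ((s *: \1 - Qsharp) \o (qc2 A \o (s *: \1 - Q)))%VF,
        op_spec Q = [set` sigma]
      & op_spec Qsharp = sharp A sigma].

Definition E_c sigma Q : {vspace E} :=
  (\sum_(s <- sigma | s \isn't Num.real) gen_eigenspace Q s)%VS.

(* [daddv_pi U V] is the projection onto [U] along [V]; the decomposition of
   [E] into [E_c] and the [ker A(t)], for [t] in [sigma] real, is direct when
   [Q] is the spectral right root for an admissible [sigma]. *)
Definition ker_component A sigma Q s : 'End(E) :=
  daddv_pi (lker (quad_eval A s))
    (E_c sigma Q +
     \sum_(t <- sigma | (t \is Num.real) && (t != s)) lker (quad_eval A t))%VS.

End Quadratic.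

(* Main.v *)
Require Import Defs.
From HB Require Import structures.
From mathcomp Require Import all_boot all_order all_algebra finmap.
From mathcomp Require Import boolp classical_sets functions reals complex.

(** Write [T'] for the adjoint of [T].  The operator
    [G = A0 Q + Q' A0 + A1 + A1'] satisfies [(G u | u) = 2 Im (u | Z u)], and
    the equation [A0 Q^2 + (A1 + A1') Q + A2 = 0] together with its adjoint
    makes [Q] self-adjoint for the hermitian form [(G u | v)].  Hence the
    generalized eigenspaces of [Q] for [s] and [t] are orthogonal for that form
    unless [s] is the conjugate of [t].  As [sigma] lies in the closed upper
    half plane, [E_c] is isotropic and orthogonal to the real eigenspaces,
    which are mutually orthogonal.  On [ker A(s)], [s] real, the form is
    [(A'(s) u | u)]; its definiteness there gives both the semisimplicity of
    the real eigenvalues and the directness of the decomposition of [E]. *)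

Set Implicit Arguments.
Unset Strict Implicit.
Unset Printing Implicit Defensive.

Import Order.TTheory GRing.Theory Num.Theory.
Local Open Scope ring_scope.

(** * Sums of vectors and of subspaces over sequences *)

Lemma sum_seqD1_cond (M : nmodType) (I : eqType) (r : seq I) (P : pred I) j
    (F : I -> M) : P j -> j \in r -> uniq r ->
  \sum_(i <- r | P i) F i = F j + \sum_(i <- r | P i && (i != j)) F i.
Proof.
move=> Pj rj r_uniq; rewrite -big_filter (bigD1_seq j) ?mem_filter ?Pj //=.
  by rewrite big_filter_cond.
exact: filter_uniq.
Qed.

Lemma sumr_seq_gt0 (K : numDomainType) (I : eqType) (r : seq I) (P : pred I)
    (F : I -> K) j : j \in r -> P j -> 0 < F j ->
    (forall i, i \in r -> P i -> 0 <= F i) -> 0 < \sum_(i <- r | P i) F i.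
Proof.
move=> rj Pj Fj F_ge0; rewrite (big_rem j) //= Pj ltr_pwDl // big_seq_cond.
by apply: sumr_ge0 => i /andP[/mem_rem ri Pi]; apply: F_ge0.
Qed.

Section SumsOverSeq.
Variables (K : fieldType) (V : vectType K) (I : eqType).
Implicit Types (r : seq I) (P : pred I).

Lemma memv_sum_seqP r P (Us : I -> {vspace V}) v : uniq r ->
    v \in (\sum_(i <- r | P i) Us i)%VS ->
  exists2 x : I -> V, (forall i, x i \in Us i) & v = \sum_(i <- r | P i) x i.
Proof.
elim: r v => [|j r IHr] v /=.
  rewrite big_nil memv0 => _ /eqP->.
  by exists (fun=> 0) => [i|]; rewrite ?mem0v ?big_nil.
case/andP=> r'j r_uniq; rewrite big_cons.
(* The family found for the tail is overwritten at the head index [j]; the tail sum is unchanged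
   because [j] does not recur in [r]. *)
have extend y x0 : y \in Us j -> (forall i, x0 i \in Us i) ->
    exists x : I -> V, [/\ forall i, x i \in Us i, x j = y
      & \sum_(i <- r | P i) x i = \sum_(i <- r | P i) x0 i].
  move=> Uy Ux0; exists (fun i => if i == j then y else x0 i); split.
  - by move=> i; case: eqP => [->|].
  - by rewrite eqxx.
  rewrite big_seq_cond [RHS]big_seq_cond; apply: eq_bigr => i /andP[ri _].
  by case: eqP ri => // ->; rewrite (negPf r'j).
case: ifP => Pj; last first.
  by case/(IHr _ r_uniq)=> x Ux ->; exists x; rewrite // big_cons Pj.
case/memv_addP=> y Uy [w /(IHr _ r_uniq)[x0 Ux0 ->] ->].
have [x [Ux xj xr]] := extend _ _ Uy Ux0.
by exists x; rewrite // big_cons Pj xj xr.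
Qed.

Lemma memv_sum_seq r P (Us : I -> {vspace V}) (x : I -> V) :
    (forall i, i \in r -> P i -> x i \in Us i) ->
  \sum_(i <- r | P i) x i \in (\sum_(i <- r | P i) Us i)%VS.
Proof.
move=> Ux; rewrite big_seq_cond [X in X \in _]big_seq_cond.
elim/big_rec2: _ => [|i y W /andP[/Ux/[apply] Uxi] Wy]; first exact: mem0v.
exact: memv_add.
Qed.

Lemma sumv_seq_sup r P (Us : I -> {vspace V}) i :
  i \in r -> P i -> (Us i <= \sum_(j <- r | P j) Us j)%VS.
Proof. by move=> ri Pi; rewrite (big_rem i) //= Pi addvSl. Qed.

End SumsOverSeq.

(** * Kernels of the iterates of an endomorphism *)

Section IteratedKernels.
Variables (K : fieldType) (V : vectType K) (f : 'End(V)).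

Lemma iter_comp_lfunE n v : iter n (comp_lfun f) \1%VF v = iter n f v.
Proof. by elim: n => [|n IHn] /=; rewrite ?id_lfunE // comp_lfunE IHn. Qed.

Lemma iter_lfun0 n : iter n f 0 = 0.
Proof. by elim: n => //= n ->; rewrite linear0. Qed.

(** Each inclusion in the chain of kernels of the iterates, up to exponent [n.+1], is strict: [v]
    and its images under [f] are witnesses. So the dimension grows by at least one at each step. *)
Lemma ltn_dim_iter_lker n v : iter n f v != 0 -> iter n.+1 f v = 0 ->
  (n < \dim (lker (iter n.+1 (comp_lfun f) \1)%VF))%N.
Proof.
elim: n v => [|n IHn] v nv0 v0.
  rewrite lt0n dimv_eq0; apply: contra nv0 => /eqP ker0.
  by rewrite -memv0 -ker0 memv_ker iter_comp_lfunE v0.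
have /leq_ltn_trans-> // : (n < \dim (lker (iter n.+1 (comp_lfun f) \1)%VF))%N.
  by apply: (IHn (f v)); rewrite -iterSr.
rewrite ltn_neqAle dimvS ?andbT; last first.
  apply/subvP=> w; rewrite !memv_ker !iter_comp_lfunE /= => /eqP->.
  by rewrite linear0.
apply: contraNneq nv0 => eq_dim.
have /eqP eqV : lker (iter n.+1 (comp_lfun f) \1)%VF
            == lker (iter n.+2 (comp_lfun f) \1)%VF.
  rewrite eqEdim eq_dim leqnn andbT.
  apply/subvP=> w; rewrite !memv_ker !iter_comp_lfunE /= => /eqP->.
  by rewrite linear0.
by rewrite -iter_comp_lfunE -memv_ker eqV memv_ker iter_comp_lfunE v0.
Qed.

(** This justifies the fixed exponent in [gen_eigenspace]: the least exponent killing [v] is at most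
    the dimension, by the strict growth of the kernels. *)
Lemma iter_dim_eq0 n v : iter n f v = 0 -> iter (\dim {:V}) f v = 0.
Proof.
elim: n => [/= ->|n IHn v0]; first exact: iter_lfun0.
have [/IHn //|nv0] := eqVneq (iter n f v) 0.
have lt_n_d := leq_trans (ltn_dim_iter_lker nv0 v0) (dimvS (subvf _)).
by rewrite -(subnK lt_n_d) iterD v0 iter_lfun0.
Qed.

End IteratedKernels.

(** * Eigenvectors over an algebraically closed field *)

Lemma leigenvalue_closed (C : numClosedFieldType) (V : vectType C)
    (f : 'End(V)) :
  {:V}%VS != 0%VS -> exists a, passmx.leigenvalue f a.
Proof.
rewrite -dimv_eq0 -lt0n => V_gt0; have basV := vbasisP {:V}.
pose M := passmx.mxof (vbasis {:V}) (vbasis {:V}) f.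
have [a a_eig] := eigenvalue_closed M V_gt0; exists a.
by rewrite /passmx.leigenvalue (passmx.leigenspaceE basV) passmx.vsof_eq0.
Qed.

(* [v] is an eigenvector of the compression of [f] to a complement of [W]. *)
Lemma eigenvector_modulo (C : numClosedFieldType) (V : vectType C)
    (f : 'End(V)) (W : {vspace V}) : W != fullv ->
  exists2 v, v \notin W & exists a, (f - a *: \1)%VF v \in W.
Proof.
move=> W_proper; pose U := (W^C)%VS.
have UW0 : (U :&: W = 0)%VS by rewrite capvC capv_compl.
have UWT v : v \in (U + W)%VS by rewrite addvC addv_complf memvf.
pose g : 'End(subvs_of U) :=
  (linfun (vsproj U) \o daddv_pi U W \o f \o linfun vsval)%VF.
have gE x : vsval (g x) = daddv_pi U W (f (vsval x)).
  by rewrite !comp_lfunE !lfunE /= vsprojK ?memv_pi.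
have [|a] := leigenvalue_closed g.
  apply: contraNneq W_proper => U0.
  rewrite -(addv_complf W) -/U; suff -> : U = 0%VS by rewrite addv0.
  apply/eqP; rewrite -subv0; apply/subvP=> v Uv.
  have := memvf (vsproj U v); rewrite U0 memv0 => /eqP Uv0.
  by rewrite -[v](vsprojK Uv) memv0 Uv0.
rewrite /passmx.leigenvalue -vpick0; set x := vpick _ => x_neq0.
have gx : g x = a *: x.
  apply/eqP; rewrite -subr_eq0; have := memv_pick (passmx.leigenspace g a).
  by rewrite memv_ker -/x add_lfunE opp_lfunE scale_lfunE id_lfunE.
have Ux : vsval x \in U := subvsP x.
exists (vsval x).
  apply: contra x_neq0 => Wx.
  have : vsval x \in (U :&: W)%VS by rewrite memv_cap Ux.
  by rewrite UW0 memv0 => /eqP x0; apply/eqP/val_inj.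
exists a; rewrite add_lfunE opp_lfunE scale_lfunE id_lfunE.
(* The [U]-component of [f x] is [a *: x], so [f x - a *: x] is its [W]-component. *)
have /(congr1 vsval) := gx; rewrite gE linearZ /= => <-.
by rewrite -[X in X - _](daddv_pi_add UW0) // addrC addKr memv_pi.
Qed.

(** * Generalized eigenspaces and their sum *)

Section GeneralizedEigenspaces.
Variables (R : realType) (E : vectType R[i]).
Implicit Types (Q : 'End(E)) (s t a : R[i]).

Lemma lfun_shiftE Q s v : (Q - s *: \1)%VF v = Q v - s *: v.
Proof. by rewrite add_lfunE opp_lfunE scale_lfunE id_lfunE. Qed.

Lemma gen_eigenspaceP Q s v :
  reflect (exists n, iter n (Q - s *: \1)%VF v = 0) (v \in gen_eigenspace Q s).
Proof.
rewrite memv_ker iter_comp_lfunE; apply: (iffP eqP) => [v0|[n]].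
  by exists (\dim {:E}).
exact: iter_dim_eq0.
Qed.

(** Induction on the nilpotency order. If [(Q - t) v = (Q - s) w], then
    [(Q - s) (v - w) = (t - s) v], so a preimage of [v] is [v - w] divided by [t - s]. *)
Lemma gen_eigenspace_divr Q s t v : s != t -> v \in gen_eigenspace Q t ->
  exists2 w, w \in gen_eigenspace Q t & (Q - s *: \1)%VF w = v.
Proof.
move=> neq_st /gen_eigenspaceP[n]; elim: n v => [|n IHn] v v0.
  by exists 0; rewrite ?mem0v // linear0 -v0.
have Kv : v \in gen_eigenspace Q t by apply/gen_eigenspaceP; exists n.+1.
rewrite iterSr in v0; have [w Kw Qw] := IHn _ v0.
exists ((t - s)^-1 *: (v - w)); first by apply: memvZ; apply: memvB.
have ts_neq0 : t - s != 0 by rewrite subr_eq0 eq_sym.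
rewrite linearZ /= linearB /= Qw !lfun_shiftE opprB [X in _ *: X]addrC addrA.
by rewrite subrK -scalerBl scalerA mulVf // scale1r.
Qed.

Lemma gen_eigenspace_eq0 Q s :
  ~~ passmx.leigenvalue Q s -> gen_eigenspace Q s = 0%VS.
Proof.
rewrite negbK => /eqP ker0; apply/eqP; rewrite -subv0; apply/subvP=> v.
case/gen_eigenspaceP=> n; elim: n v => [|n IHn] v.
  by move=> /= ->; rewrite mem0v.
by rewrite iterSr => /IHn; rewrite memv0 -memv_ker [lker _]ker0.
Qed.

(** Were the sum [W] proper, some [v] outside [W] would have [(Q - s) v] in [W]. The components of
    [(Q - s) v] for [t != s] can be divided by [Q - s] inside [W]; subtracting the quotient [y] from
    [v] leaves a generalized eigenvector for [s], so [v] lies in [W] after all. *)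
Lemma sum_gen_eigenspace Q (r : seq R[i]) :
  (forall s, passmx.leigenvalue Q s -> s \in r) ->
  (\sum_(s <- r) gen_eigenspace Q s)%VS = fullv.
Proof.
move=> r_spec; set W := (\sum_(s <- r) _)%VS; apply/eqP/negPn/negP.
(* Needed for every [s], since the [s] obtained below is not known to be in [r]. *)
have sub_K s : (gen_eigenspace Q s <= W)%VS.
  have [/r_spec rs|/gen_eigenspace_eq0->] := boolP (passmx.leigenvalue Q s).
    exact: sumv_seq_sup.
  exact: sub0v.
case/(eigenvector_modulo Q) => v W'v [s Ww].
have W_divr w : w \in W ->
    exists2 y, y \in W & w - (Q - s *: \1)%VF y \in gen_eigenspace Q s.
  rewrite {1}/W big_seq; elim/big_rec: _ => [|t U rt IHU] in w *.
    rewrite memv0 => /eqP->.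
    by exists 0; rewrite ?mem0v // linear0 subr0 mem0v.
  case/memv_addP=> w1 Kw1 [w2 /IHU[y2 Wy2 Ky2] ->].
  have [eq_ts|neq_ts] := eqVneq t s.
    exists y2; first exact: Wy2.
    by rewrite -addrA; apply: memvD; [rewrite -eq_ts; exact: Kw1|exact: Ky2].
  rewrite eq_sym in neq_ts; have [y1 Ky1 <-] := gen_eigenspace_divr neq_ts Kw1.
  exists (y1 + y2); last first.
    suff -> : (Q - s *: \1)%VF y1 + w2 - (Q - s *: \1)%VF (y1 + y2)
              = w2 - (Q - s *: \1)%VF y2 by exact: Ky2.
    by move: (Q - s *: \1)%VF => f; rewrite linearD /= opprD addrACA subrr add0r.
  by apply: memvD; [exact: (subvP (sub_K t))|exact: Wy2].
have [y Wy] := W_divr _ Ww; rewrite -linearB => Ky.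
have Kvy : v - y \in gen_eigenspace Q s.
  have /gen_eigenspaceP[n vy0] := Ky; apply/gen_eigenspaceP; exists n.+1.
  by rewrite iterSr.
case/negP: W'v; rewrite -[v](subrK y).
by apply: memvD; [exact: (subvP (sub_K s))|exact: Wy].
Qed.

End GeneralizedEigenspaces.

Lemma daddv_pi_eq0 (K : fieldType) (V : vectType K) (U W : {vspace V}) w :
  (U :&: W = 0)%VS -> w \in W -> daddv_pi U W w = 0.
Proof.
move=> UW0 Ww; have WU0 : (W :&: U = 0)%VS by rewrite capvC.
have Sw : w \in (U + W)%VS by rewrite (subvP (addvSr _ _)).
apply: (addIr (daddv_pi W U w)).
by rewrite (daddv_pi_add UW0 Sw) add0r daddv_pi_id.
Qed.

(** * Operators self-adjoint for the form [(G u | v)] *)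

Section FormSelfAdjoint.
Variables (R : realType) (E : vectType R[i]).
Variable form : {dot E for @Num.conj R[i]}.
Variables G Q : 'End(E).
Hypothesis Q_selfadj : forall u v, form (G (Q u)) v = form (G u) (Q v).
Implicit Types s t : R[i].

Lemma form_shiftl s u v :
  form (G ((Q - s *: \1)%VF u)) v = form (G u) (Q v) - s * form (G u) v.
Proof.
rewrite lfun_shiftE -Q_selfadj linearB linearBl; congr (_ - _).
by rewrite linearZ linearZl_LR.
Qed.

Lemma form_shiftr s u v :
  form u ((Q - s *: \1)%VF v) = form u (Q v) - s^* * form u v.
Proof. by rewrite lfun_shiftE linearBr linearZr_LR. Qed.

(** Double induction on the nilpotency orders. Vanishing on the pairs [((Q - s) u, v)] and
    [(u, (Q - t) v)] gives [(G u | Q v) = s (G u | v) = conj t (G u | v)], and [s] differs from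
    [conj t]. *)
Lemma gen_eigenspace_orthogonal s t u v : s != t^* ->
  u \in gen_eigenspace Q s -> v \in gen_eigenspace Q t -> form (G u) v = 0.
Proof.
move=> neq_st /gen_eigenspaceP[m u0] /gen_eigenspaceP[n v0].
elim: m => [|m IHm] in u v n u0 v0 *.
  by rewrite (_ : u = 0) ?linear0 ?linear0l.
elim: n => [|n IHn] in v v0 *; first by rewrite (_ : v = 0) ?linear0r.
rewrite iterSr in u0.
have := IHm _ _ _ u0 v0; rewrite iterSr in v0; have := IHn _ v0.
rewrite form_shiftl form_shiftr.
move=> /eqP; rewrite subr_eq0 => /eqP ->.
by move=> /eqP; rewrite -mulrBl mulf_eq0 subr_eq0 eq_sym (negPf neq_st) => /eqP.
Qed.

(* A vector [(Q - s) v] of [ker (Q - s)] is isotropic for [(G _ | _)]. *)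
Lemma gen_eigenspace_semisimple s : s \is Num.real ->
    (forall v, v \in lker (Q - s *: \1)%VF -> form (G v) v = 0 -> v = 0) ->
  gen_eigenspace Q s = lker (Q - s *: \1)%VF.
Proof.
move=> s_real anis; apply/vspaceP=> v; apply/gen_eigenspaceP/idP; last first.
  by rewrite memv_ker => /eqP v0; exists 1.
case=> n; elim: n v => [|n IHn] v; first by move=> /= ->; rewrite mem0v.
rewrite iterSr => /IHn Kw; rewrite memv_ker; apply/eqP/anis=> //.
move: Kw; set w := (_ v); rewrite memv_ker lfun_shiftE subr_eq0 => /eqP Qw.
(* Self-adjointness moves [Q - s] from the first [w] onto the second, which it kills because [s] is
   real. *)
by rewrite {1}/w form_shiftl Qw linearZr_LR /= (CrealP s_real) subrr.
Qed.

(** * The decomposition into [E_c] and the real eigenspaces *)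

Variables (sigma : {fset R[i]}) (Us : R[i] -> {vspace E}).
Hypothesis spec_sub : forall s, passmx.leigenvalue Q s -> s \in sigma.
Hypothesis sigma_Im : forall s, s \in sigma -> 0 <= 'Im s.
Hypothesis UsE : forall s, s \in sigma -> s \is Num.real ->
  Us s = lker (Q - s *: \1)%VF.
Hypothesis Us_anis : forall s v, s \in sigma -> s \is Num.real ->
  v \in Us s -> form (G v) v = 0 -> v = 0.

(** With [lker (quad_eval A s)] for [Us s] this is [ker_component] by conversion. *)
Let comp s := daddv_pi (Us s)
  (E_c sigma Q + \sum_(t <- sigma | (t \is Num.real) && (t != s)) Us t)%VS.

Let K_real s : s \in sigma -> s \is Num.real -> gen_eigenspace Q s = Us s.
Proof.
move=> ss s_real; rewrite (UsE ss s_real).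
apply: (gen_eigenspace_semisimple s_real) => v.
by rewrite -(UsE ss s_real); apply: Us_anis.
Qed.

(** Two points of the closed upper half plane can be conjugate only if both are real. The case
    [s = t] is included, which makes [E_c] isotropic. *)
Let neq_conj_r s t :
  s \in sigma -> t \in sigma -> t \isn't Num.real -> s != t^*.
Proof.
move=> ss ts; apply: contraNneq => s_eq; apply/Creal_ImP.
have := sigma_Im ss; rewrite s_eq Im_conj oppr_ge0 => t_le0.
by apply/eqP; rewrite eq_le t_le0 sigma_Im.
Qed.

Let neq_conj_l s t :
  s \in sigma -> t \in sigma -> s \isn't Num.real -> s != t^*.
Proof.
move=> ss ts Ns; have := neq_conj_r ts ss Ns.
by apply: contraNneq => ->; rewrite conjCK.
Qed.

(** Both orders of the arguments are recorded, as [G] itself is not assumed self-adjoint in this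
    section. *)
Lemma E_c_orthogonal s c v : s \in sigma -> c \in E_c sigma Q ->
  v \in gen_eigenspace Q s -> form (G c) v = 0 /\ form (G v) c = 0.
Proof.
move=> ss /(memv_sum_seqP (fset_uniq _))[x Kx ->] Kv.
rewrite linear_sum linear_sumlz linear_sumr.
split; rewrite big_seq_cond big1 // => t /andP[ts Nt] /=.
  exact: (gen_eigenspace_orthogonal (neq_conj_l ts ss Nt) (Kx t) Kv).
exact: (gen_eigenspace_orthogonal (neq_conj_r ss ts Nt) Kv (Kx t)).
Qed.

Lemma E_c_isotropic c d : c \in E_c sigma Q -> d \in E_c sigma Q ->
  form (G c) d = 0.
Proof.
move=> Ec /(memv_sum_seqP (fset_uniq _))[x Kx ->].
rewrite linear_sumr big_seq_cond big1 // => t /andP[ts _].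
by have [] := E_c_orthogonal ts Ec (Kx t).
Qed.

Lemma eigenspaces_orthogonal s t u v : s \in sigma -> s \is Num.real ->
    t \in sigma -> t \is Num.real -> s != t -> u \in Us s -> v \in Us t ->
  form (G u) v = 0.
Proof.
move=> ss s_real ts t_real neq_st; rewrite -!K_real //.
by apply: gen_eigenspace_orthogonal; rewrite (CrealP t_real).
Qed.

(** Directness comes from the form: a common vector [w], written in the second space, is orthogonal
    to itself as an element of [Us s], where the form is anisotropic. *)
Lemma eigenspace_cap0 s : s \in sigma -> s \is Num.real ->
  (Us s :&: (E_c sigma Q +
     \sum_(t <- sigma | (t \is Num.real) && (t != s)) Us t) = 0)%VS.
Proof.
move=> ss s_real; apply/eqP; rewrite -subv0; apply/subvP=> w.
rewrite memv_cap => /andP[Uw /memv_addP[c Ec [y]]].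
case/(memv_sum_seqP (fset_uniq _)) => x Ux -> w_eq.
rewrite memv0; apply/eqP/(Us_anis ss s_real Uw).
rewrite [X in form _ X]w_eq linearDr linear_sumr /=.
have Kw : w \in gen_eigenspace Q s by rewrite (K_real ss s_real).
have [_ ->] := E_c_orthogonal ss Ec Kw.
rewrite add0r big_seq_cond big1 // => t /and3P[ts t_real neq_ts].
by apply: (@eigenspaces_orthogonal s t) => //; rewrite eq_sym.
Qed.

(** The generalized eigenspaces span the space. Grouping their components into real and non-real
    ones leaves an element of [E_c] once the real ones are removed. *)
Lemma E_c_decomposition u :
  u - \sum_(s <- sigma | s \is Num.real) comp s u \in E_c sigma Q.
Proof.
have : u \in (\sum_(s <- sigma) gen_eigenspace Q s)%VS.
  by rewrite sum_gen_eigenspace // memvf.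
case/(memv_sum_seqP (fset_uniq _)) => x Kx u_eq.
pose c := \sum_(s <- sigma | s \isn't Num.real) x s.
have Ec : c \in E_c sigma Q by apply: memv_sum_seq.
have {}u_eq : u = \sum_(s <- sigma | s \is Num.real) x s + c.
  by rewrite u_eq (bigID [pred s | s \is Num.real]).
(* The projection recovers the chosen component: [x s] lies in [Us s] and all other terms lie in the
   complementary space. *)
have compE s : s \in sigma -> s \is Num.real -> comp s u = x s.
  move=> ss s_real; have UV0 := eigenspace_cap0 ss s_real.
  have Ux : x s \in Us s by rewrite -K_real.
  rewrite u_eq (sum_seqD1_cond x s_real ss (fset_uniq _)) -addrA linearD /=.
  rewrite daddv_pi_id // daddv_pi_eq0 ?addr0 // addrC; apply: memv_add => //.
  apply: memv_sum_seq => t ts /andP[t_real _].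
  by rewrite -(K_real ts t_real).
suff -> : \sum_(s <- sigma | s \is Num.real) comp s u
          = \sum_(s <- sigma | s \is Num.real) x s.
  by rewrite {1}u_eq addrC addKr.
rewrite big_seq_cond [RHS]big_seq_cond.
by apply: eq_bigr => s /andP[]; apply: compE.
Qed.

Lemma form_decomposition u : form (G u) u =
  \sum_(s <- sigma | s \is Num.real) form (G (comp s u)) (comp s u).
Proof.
pose x s := comp s u.
rewrite -[RHS]/(\sum_(s <- sigma | s \is Num.real) form (G (x s)) (x s)).
have Ux s : x s \in Us s by exact: memv_pi.
have [c Ec u_eq] : exists2 c, c \in E_c sigma Q
    & u = \sum_(s <- sigma | s \is Num.real) x s + c.
  exists (u - \sum_(s <- sigma | s \is Num.real) x s).
    exact: E_c_decomposition.
  by rewrite addrC subrK.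
clearbody x; rewrite u_eq.
rewrite (linearD G) linearDl !linearDr /= (E_c_isotropic Ec Ec).
have -> : form (G c) (\sum_(s <- sigma | s \is Num.real) x s) = 0.
  rewrite linear_sumr big_seq_cond big1 // => s /andP[ss s_real] /=.
  have Kx : x s \in gen_eigenspace Q s by rewrite (K_real ss s_real).
  by have [->] := E_c_orthogonal ss Ec Kx.
have -> : form (G (\sum_(s <- sigma | s \is Num.real) x s)) c = 0.
  rewrite linear_sum linear_sumlz big_seq_cond big1 // => s /andP[ss s_real] /=.
  have Kx : x s \in gen_eigenspace Q s by rewrite (K_real ss s_real).
  by have [_ ->] := E_c_orthogonal ss Ec Kx.
rewrite !addr0 (linear_sum G) linear_sumlz big_seq_cond [RHS]big_seq_cond.
apply: eq_bigr => s /andP[ss s_real] /=.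
rewrite linear_sumr (sum_seqD1_cond _ s_real ss (fset_uniq _)) /=.
rewrite big_seq_cond big1 ?addr0 // => t /and3P[ts t_real neq_ts].
by apply: (@eigenspaces_orthogonal s t) => //; rewrite eq_sym.
Qed.

End FormSelfAdjoint.

(** The factor [- 'i] of [Z] leaves the conjugate linear argument as ['i], which turns the imaginary
    part into a real part. *)
Lemma Im_conj_NiM (C : numClosedFieldType) (c : C) :
  2 * 'Im ((- 'i)^* * c) = c^* + c.
Proof.
have -> : (- 'i)^* = 'i :> C by rewrite rmorphN /= conjCi opprK.
rewrite ImE rmorphM /= conjCi mulrC divfK ?pnatr_eq0 //.
by rewrite mulrBr !mulrA mulrN -expr2 sqrCi opprK mul1r mulN1r opprK.
Qed.

(** * Adjoints and the scalar product *)

Section Adjoint.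
Variables (R : realType) (E : vectType R[i]).
Variable form : {dot E for @Num.conj R[i]}.
Implicit Types f : 'End(E).

Lemma form_conj u v : form u v = (form v u)^*.
Proof. by rewrite hermC mul1r. Qed.

Lemma adjoint_form f u v : form (adjoint form f u) v = form u (f v).
Proof. by rewrite form_conj -(adjointP form f) -form_conj. Qed.

Lemma self_adjoint_form f : self_adjoint form f ->
  forall u v, form (f u) v = form u (f v).
Proof. by move=> f_sa u v; rewrite (adjointP form f) f_sa. Qed.

End Adjoint.

(** * The right root and its Gram operator *)

Section SpectralRoot.
Variables (R : realType) (E : vectType R[i]).
Variable form : {dot E for @Num.conj R[i]}.
Variables A0 A1 A2 Q : 'End(E).

Let A := Quad A0 (A1 + adjoint form A1) A2.
Let Z := - 'i *: ((A0 \o Q)%VF + A1).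

(** For self-adjoint [A0] this is [T + T'] with [T = A0 Q + A1 = 'i Z]. *)
Definition root_gram : 'End(E) :=
  ((A0 \o Q) + (adjoint form Q \o A0) + (A1 + adjoint form A1))%VF.

Hypothesis A0_pos : positive_definite form A0.
Hypothesis A2_sa : self_adjoint form A2.

Lemma root_gramE u v : form (root_gram u) v =
  form (A0 (Q u)) v + form (A0 u) (Q v) + form (A1 u + adjoint form A1 u) v.
Proof.
by rewrite !add_lfunE !comp_lfunE !linearDl /= adjoint_form.
Qed.

Lemma Im_impedance u : 2 * 'Im (form u (Z u)) = form (root_gram u) u.
Proof.
have A0_sa := self_adjoint_form (proj1 A0_pos).
rewrite root_gramE /Z scale_lfunE linearZr_LR /=.
rewrite add_lfunE comp_lfunE; set w := _ + _.
rewrite Im_conj_NiM -form_conj /w linearDl linearDr linearDl /=.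
rewrite adjoint_form -A0_sa; exact: addrACA.
Qed.

Variable Qs : 'End(E).
Hypothesis A_factor : forall s, quad_eval A s =
  ((s *: \1 - Qs) \o (A0 \o (s *: \1 - Q)))%VF.

Lemma quad_evalE s u :
  quad_eval A s u = s ^+ 2 *: A0 u + s *: (A1 u + adjoint form A1 u) + A2 u.
Proof. by rewrite !add_lfunE !scale_lfunE !add_lfunE. Qed.

Lemma quad_eval_factor s u :
  quad_eval A s u = s *: A0 (s *: u - Q u) - Qs (A0 (s *: u - Q u)).
Proof.
by rewrite A_factor !comp_lfunE !add_lfunE !opp_lfunE !scale_lfunE !id_lfunE.
Qed.

(** Two values of the factorization suffice: [s = 0] gives [A2 = Qs A0 Q], then [s = 1] gives
    [A1 + A1' = - A0 Q - Qs A0]; eliminating [Qs] leaves the equation. *)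
Lemma right_root_eq u :
  A0 (Q (Q u)) + (A1 (Q u) + adjoint form A1 (Q u)) + A2 u = 0.
Proof.
have A2E w : A2 w = Qs (A0 (Q w)).
  have := quad_eval_factor 0 w; rewrite quad_evalE expr0n !scale0r !add0r.
  by rewrite !linearN /= opprK.
have HE w : A1 w + adjoint form A1 w = - A0 (Q w) - Qs (A0 w).
  have := quad_eval_factor 1 w; rewrite quad_evalE expr1n !scale1r A2E.
  move: (A1 w + _) => h; rewrite !(linearB A0) (linearB Qs) /= opprB.
  rewrite [X in _ = _ + X]addrC addrA.
  by move/addIr; rewrite -addrA; move/addrI.
by rewrite HE A2E addrA addrN add0r addNr.
Qed.

(** By the root equation both sides equal [(A0 Q u | Q v) - (A2 u | v)]. *)
Lemma root_gram_selfadj u v :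
  form (root_gram (Q u)) v = form (root_gram u) (Q v).
Proof.
have A0_sa := self_adjoint_form (proj1 A0_pos).
have H_sa x y :
    form (A1 x + adjoint form A1 x) y = form x (A1 y + adjoint form A1 y).
  by rewrite linearDl linearDr /= adjoint_form -(adjointP form A1) addrC.
have root x : A0 (Q (Q x)) + (A1 (Q x) + adjoint form A1 (Q x)) = - A2 x.
  by apply/eqP; rewrite -addr_eq0 right_root_eq.
rewrite !root_gramE addrAC -linearDl /= root [X in _ = X + _]addrC -addrA.
rewrite !A0_sa H_sa.
rewrite [RHS]addrCA -linearDr /= root linearNr linearNl /= addrC.
by congr (_ - _); exact: self_adjoint_form.
Qed.

(** For real [s] both terms containing [Q] contribute [s (A0 u | u)], which together give the
    [2 s A0] of the derivative. *)
Lemma root_gram_eigen s u : Q u = s *: u -> s \is Num.real ->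
  form (root_gram u) u = form (quad_deriv A s u) u.
Proof.
move=> Qu s_real; rewrite root_gramE Qu linearZr_LR /= (CrealP s_real).
rewrite /quad_deriv !add_lfunE scale_lfunE !linearDl /= linearZl_LR.
have -> : A0 (s *: u) = s *: A0 u by exact: linearZ.
by rewrite linearZl_LR /= -mulrDl mulr_natl mulr2n.
Qed.

(** The left factor is injective off the spectrum of [Qs], and [A0] is injective by definiteness, so
    only the right factor [s - Q] contributes to the kernel. *)
Lemma lker_quad_eval s : ~ op_spec Qs s ->
  lker (quad_eval A s) = lker (Q - s *: \1)%VF.
Proof.
move=> /negP; rewrite negbK => /eqP kerQs; apply/vspaceP=> v.
rewrite [LHS]memv_ker [RHS]memv_ker (lfun_shiftE Q); apply/eqP/eqP => [|/eqP].
  rewrite quad_eval_factor => /eqP; rewrite subr_eq0.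
  set w := s *: v - Q v => /eqP QsA0w.
  have : A0 w \in lker (Qs - s *: \1)%VF.
    by rewrite memv_ker lfun_shiftE -QsA0w subrr.
  rewrite [lker _]kerQs memv0 => /eqP A0w.
  rewrite -opprB -/w; apply/eqP; rewrite oppr_eq0.
  by apply/negPn/negP => /(proj2 A0_pos); rewrite A0w linear0l ltxx.
rewrite subr_eq0 => /eqP Qv; rewrite quad_eval_factor Qv subrr.
by rewrite (linear0 A0) (linear0 Qs) scaler0 subr0.
Qed.

End SpectralRoot.

(** * The imaginary part of the impedance *)

Theorem propositionB5 (R : realType) (E : vectType R[i])
    (form : {dot E for @Num.conj R[i]}) (A0 A1 A2 : 'End(E))
    (sigma : {fset R[i]}) (Q : 'End(E)) :
  let A := Quad A0 (A1 + adjoint form A1) A2 in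
  let Z := - 'i *: ((A0 \o Q)%VF + A1) in
  positive_definite form A0 ->
  self_adjoint form A2 ->
  (forall s, quad_spec A s -> s \is Num.real ->
     positive_type form A s \/ negative_type form A s) ->
  admissible form A sigma ->
  spectral_right_root A sigma Q ->
  (forall u : E,
     2 * 'Im (form u (Z u)) =
     \sum_(s <- sigma | s \is Num.real)
        form (quad_deriv A s (ker_component A sigma Q s u))
             (ker_component A sigma Q s u)) /\
  (sigma_positive form A sigma ->
     forall u : E, 0 <= 'Im (form u (Z u)) /\
       (u \notin E_c sigma Q -> 0 < 'Im (form u (Z u)))) /\
  (sigma_negative form A sigma ->
     forall u : E, 'Im (form u (Z u)) <= 0 /\
       (u \notin E_c sigma Q -> 'Im (form u (Z u)) < 0)).
Proof.
move=> A Z A0_pos A2_sa types [sigma_spec _ _ sigma_Im].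
case=> Qs [A_factor specQ specQs].
have spec_sub s : passmx.leigenvalue Q s -> s \in sigma.
  by move=> Qs_eig; have : op_spec Q s by []; rewrite specQ.
have kerE s : s \in sigma -> lker (quad_eval A s) = lker (Q - s *: \1)%VF.
  (* The spectrum of [Qs] is the complement of [sigma] in the spectrum of [A], so it does not
     contain [s]. *)
  move=> ss; apply: (lker_quad_eval A0_pos A_factor).
  by rewrite specQs => -[_]; apply.
have eigen s v : v \in lker (Q - s *: \1)%VF -> Q v = s *: v.
  by rewrite memv_ker lfun_shiftE subr_eq0 => /eqP.
have gramE s v : s \in sigma -> s \is Num.real -> v \in lker (quad_eval A s) ->
    form (root_gram form A0 A1 Q v) v = form (quad_deriv A s v) v.
  by move=> ss s_real; rewrite (kerE s ss) => /eigen Qv; apply: root_gram_eigen.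
have anis s v : s \in sigma -> s \is Num.real -> v \in lker (quad_eval A s) ->
    form (root_gram form A0 A1 Q v) v = 0 -> v = 0.
  move=> ss s_real Kv; rewrite (gramE s v ss s_real Kv) => v0.
  apply/eqP/negPn/negP => v_neq0.
  have [/(_ v Kv v_neq0)|/(_ v Kv v_neq0)] := types s (sigma_spec s ss) s_real;
    by rewrite v0 ltxx.
have selfadj := root_gram_selfadj A0_pos A2_sa A_factor.
have kerQ s : s \in sigma -> s \is Num.real ->
    lker (quad_eval A s) = lker (Q - s *: \1)%VF by move=> ss _; apply: kerE.
pose x s u := ker_component A sigma Q s u.
have Kx s u : x s u \in lker (quad_eval A s) by exact: memv_pi.
have Im_sum u : 2 * 'Im (form u (Z u)) =
    \sum_(s <- sigma | s \is Num.real) form (quad_deriv A s (x s u)) (x s u).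
  rewrite (Im_impedance A1 Q A0_pos).
  rewrite (form_decomposition selfadj spec_sub sigma_Im kerQ anis).
  rewrite big_seq_cond [RHS]big_seq_cond; apply: eq_bigr => s /andP[ss s_real].
  exact: (gramE s (x s u) ss s_real (Kx s u)).
have x_neq0 u : u \notin E_c sigma Q ->
    exists2 s, s \in sigma & s \is Num.real /\ x s u != 0.
  move=> Eu; apply: contrapT => no_s; case/negP: Eu.
  have := E_c_decomposition selfadj spec_sub sigma_Im kerQ anis u.
  rewrite big_seq_cond big1 ?subr0 // => s /andP[ss s_real].
  by apply/eqP/negPn/negP => xs; apply: no_s; exists s.
(* The factor [c] treats both types at once: it is taken as 1 for positive and -1 for negative
   type. *)
have signed (c : R[i]) : (forall s v, s \in sigma -> s \is Num.real ->
      v \in lker (quad_eval A s) -> v != 0 ->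
      0 < c * form (quad_deriv A s v) v) ->
    forall u, 0 <= c * (2 * 'Im (form u (Z u))) /\
      (u \notin E_c sigma Q -> 0 < c * (2 * 'Im (form u (Z u)))).
  move=> c_gt0 u; rewrite Im_sum mulr_sumr.
  have term_ge0 s : s \in sigma -> s \is Num.real ->
      0 <= c * form (quad_deriv A s (x s u)) (x s u).
    move=> ss s_real; have [->|xs_neq0] := eqVneq (x s u) 0.
      by rewrite linear0r mulr0.
    exact/ltW/c_gt0.
  split.
    by rewrite big_seq_cond; apply: sumr_ge0 => s /andP[]; apply: term_ge0.
  case/x_neq0 => s ss [s_real xs].
  exact: (sumr_seq_gt0 ss s_real (c_gt0 s _ ss s_real (Kx s u) xs) term_ge0).
have two_gt0 : 0 < 2 :> R[i] by [].
split; [exact: Im_sum | split] => [[pos _]|[neg _]] u.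
  have [s v ss s_real Kv v_neq0|] := signed 1 _ u.
    by rewrite mul1r; apply: (pos s).
  by rewrite mul1r pmulr_rge0 // pmulr_rgt0.
have [s v ss s_real Kv v_neq0|] := signed (-1) _ u.
  by rewrite mulN1r oppr_gt0; apply: (neg s).
by rewrite mulN1r oppr_ge0 oppr_gt0 pmulr_rle0 // pmulr_rlt0.
Qed.
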